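(* Let $q$ be a prime power, let $m\geq 4$ be an even integer, $h=m/2$, and let $\delta\in \left[q^{h}, q^{\lfloor(2m-1)/3\rfloor +1}\right)$ be an integer. Let $j=j_\delta$ be the integer such that $q^{h+j}\leq \delta<q^{h+j+1}$, let $\sum_{\ell=0}^{h+j}\delta_{\ell}q^{\ell}$ be the $q$-adic expansion of $\delta$ (digits $0\le\delta_\ell\le q-1$), and let $r=r_{\delta}$ be the smallest integer in $[-j,j]$ such that $\delta_{h+r}>0$. Put $$L=\sum_{\ell=0}^{h-j-1}\delta_\ell q^\ell,\qquad U=\sum_{\ell=h-r}^{h+j}\delta_{\ell}q^{\ell-(h-r)},\qquad \hat{\delta}= \sum_{\ell=h+r}^{h+j}\delta_{\ell}q^{\ell}+ U.$$ (i) If $r\neq 0$ and $q\nmid \delta$, then $$d_B(\mathcal{C}_{(q,m,\delta)})=\begin{cases}\delta, & \text{if } L>U,\\ \hat\delta+1, & \text{if } L\le U \text{ and } \delta_{h-r}\neq q-1,\\ \hat\delta+2, & \text{if } L\le U \text{ and } \delta_{h-r}=q-1.\end{cases}$$ (ii) If $r\neq 0$ and $q\mid \delta$, then $$d_B(\mathcal{C}_{(q,m,\delta)})=\begin{cases}\delta+1, & \text{if } L\ge U,\\ \hat\delta+1, & \text{if } L<U \text{ and } \delta_{h-r}\neq q-1,\\ \hat\delta+2, & \text{if } L<U \text{ and } \delta_{h-r}=q-1.\end{cases}$$ (iii) If $r=0$ (so that $U=\sum_{\ell=h}^{h+j}\delta_\ell q^{\ell-h}$), then $$d_B(\mathcal{C}_{(q,m,\delta)})=\begin{cases}\delta,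 & \text{if } L>U \text{ and } q\nmid\delta,\\ \delta+1, & \text{if } L>U \text{ and } q\mid\delta,\\ \hat\delta, & \text{if } L\le U.\end{cases}$$
   Context: Let $\alpha$ be a primitive element of $\mathbb{F}_{q^m}$, $n=q^m-1$, and for an integer $i$ let $m_i(x)$ be the minimal polynomial of $\alpha^i$ over $\mathbb{F}_q$. For an integer $2\le\delta\le n$, $\mathcal{C}_{(q,m,\delta)}$ is the (narrow-sense primitive BCH) cyclic code of length $n$ over $\mathbb{F}_q$, i.e. the ideal of $\mathbb{F}_q[x]/(x^n-1)$, generated by $\mathrm{lcm}(m_1(x),\ldots,m_{\delta-1}(x))$. Its Bose distance $d_B(\mathcal{C}_{(q,m,\delta)})$ is the largest integer $d$ (with $2\le d\le n$) such that $\mathcal{C}_{(q,m,\delta)}=\mathcal{C}_{(q,m,d)}$. *)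

(* Defs.v *)
From mathcomp Require Import all_boot all_order all_algebra all_field.

Set Implicit Arguments.
Unset Strict Implicit.
Unset Printing Implicit Defensive.

Import GRing.Theory.
Local Open Scope ring_scope.

Section Lcmp.
Variable F : fieldType.
Implicit Types p q r : {poly F}.

(* As for [gcdp], only meaningful up to a nonzero constant factor. *)
Definition lcmp p q : {poly F} := p * q %/ gcdp p q.

Lemma dvdp_lcm p q r : (lcmp p q %| r) = (p %| r) && (q %| r).
Proof.
have [g0 | gN0] := eqVneq (gcdp p q) 0.
  move/eqP: g0; rewrite gcdp_eq0 => /andP[/eqP-> /eqP->].
  by rewrite /lcmp mul0r div0p andbb.
have lE : lcmp p q * gcdp p q = p * q.
  by rewrite /lcmp divpK // dvdp_mulr // dvdp_gcdl.
have pl : p %| lcmp p q.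
  by rewrite -(dvdp_mul2r _ _ gN0) lE dvdp_mul // dvdp_gcdr.
have ql : q %| lcmp p q.
  by rewrite -(dvdp_mul2r _ _ gN0) lE mulrC dvdp_mul // dvdp_gcdl.
apply/idP/andP => [lr | [pr qr]].
  by split; [apply: dvdp_trans pl lr | apply: dvdp_trans ql lr].
rewrite -(dvdp_mul2r _ _ gN0) lE (eqp_dvdr _ (mulp_gcdr p q r)) dvdp_gcd.
by rewrite [r * p]mulrC !dvdp_mul.
Qed.

End Lcmp.

Section BCH.
Variables (F : finFieldType) (E : fieldExtType F).
Implicit Types (x alpha : E) (delta : nat).

Fact minPolyF_subproof x :
  exists p : {poly F}, map_poly (in_alg E) p == minPoly 1%AS x.
Proof. by have /polyOver1P[p ->] := minPolyOver 1%AS x; exists p. Qed.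

(* [minPoly 1 x] lies in {poly E}, with coefficients in the copy of F in E;
   this is the same polynomial read in {poly F}. *)
Definition minPolyF x : {poly F} := xchoose (minPolyF_subproof x).

Lemma map_minPolyF x : map_poly (in_alg E) (minPolyF x) = minPoly 1%AS x.
Proof. exact/eqP/(xchooseP (minPolyF_subproof x)). Qed.

(* n = q ^ m - 1 with q = #|F| and m = [E : F]. *)
Definition bch_length : nat := (#|F| ^ \dim {:E} - 1)%N.

Definition bch_ambient := {poly %/ ('X^bch_length - 1 : {poly F})}.

Definition bch_gen alpha delta : {poly F} :=
  \big[@lcmp F/1]_(1 <= i < delta) minPolyF (alpha ^+ i).

(* The principal ideal of F[X]/(X^n - 1) generated by [bch_gen alpha delta]. *)
Definition bch_code alpha delta : {set bch_ambient} :=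
  [set in_qpoly ('X^bch_length - 1) (bch_gen alpha delta) * u
     | u in [set: bch_ambient]].

(* The largest d in [2, n] with C_d = C; the value is 0 when C is none of the
   codes C_2, ..., C_n. *)
Definition bose_distance alpha (C : {set bch_ambient}) : nat :=
  \max_(2 <= d < bch_length.+1 | bch_code alpha d == C) d.

End BCH.

(* Main.v *)
(* The zeros of the generator of C_d are the conjugates alpha^(i q^k) of the
   alpha^i with 0 < i < d, so the Bose distance of C_delta is the least integer
   x >= delta that is the smallest element of its q-cyclotomic coset mod
   n = q^m - 1, residues being taken in [1, n].  If x = b q^c + a with a < q^c,
   then x q^(m-c) = a q^(m-c) + b mod n, so x is such a leader iff
   x <= a q^(m-c) + b for all 0 < c < m.  Write x = B q^t + a with t = h + r,
   q not dividing B, and a < q^(h-j).  As 3 j < h, when q does not divide a the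
   only shift that can produce something smaller is the one at c = t, and there
   the inequality holds exactly when a exceeds U (or a = U and r = 0).  Hence the
   next leader is obtained from delta by raising its low part L to the least
   admissible value that is not divisible by q. *)
From HB Require Import structures.
Require Import Defs.
From mathcomp Require Import all_boot all_order all_algebra all_field.
From mathcomp Require Import zify.

Set Implicit Arguments.
Unset Strict Implicit.
Unset Printing Implicit Defensive.

Import GRing.Theory.

(** * Cyclotomic coset leaders and rotations of q-ary words *)

Section CosetLeaders.
Implicit Types q m n h j t a b c i k x y : nat.

(* With i > 0 only, the zero class is represented by n itself, not by 0. *)
Definition coset_leader q n x :=
  forall i k, 0 < i -> x = i * q ^ k %[mod n] -> x <= i.

Definition conj_to_smaller q n y :=
  exists i k, 0 < i < y /\ y = i * q ^ k %[mod n].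

(** Exponents in [[d, x)] bring no new zero to the generator, whereas [x] does; this is what pins
    down the Bose distance. *)
Definition next_leader q n d x :=
  [/\ d <= x <= n, forall y, d <= y < x -> conj_to_smaller q n y
    & coset_leader q n x].

Lemma modn_eq_leq n x y : 0 < y -> x <= n -> x = y %[mod n] -> x <= y.
Proof.
move=> y_gt0 xn /eqP xy; rewrite leqNgt; apply/negP => yx.
move: xy; rewrite eqn_mod_dvd ?(ltnW yx) // => /dvdn_leq.
lia.
Qed.

Lemma expn_modn_period q m n k : q ^ m = 1 %[mod n] ->
  q ^ k = q ^ (k %% m) %[mod n].
Proof.
move=> qm; rewrite {1}(divn_eq k m) expnD [k %/ m * m]mulnC expnM.
by rewrite -modnMml -modnXm qm modnXm exp1n modnMml mul1n.
Qed.

Lemma shift_modn q m n c a b : c <= m -> q ^ m = 1 %[mod n] ->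
  (b * q ^ c + a) * q ^ (m - c) = a * q ^ (m - c) + b %[mod n].
Proof.
move=> cm qm; rewrite mulnDl -mulnA -expnD subnKC // addnC -modnDmr -modnMmr qm.
by rewrite modnMmr muln1 modnDmr.
Qed.

(** If [x] is [i * q ^ k] mod n with [k < m], multiplying by [q ^ (m - k)] recovers [i] mod n. The
    rotated word it produces is at most n, so it cannot exceed the positive representative [i]. *)
Lemma coset_leader_shifts q m x : 1 < q -> 0 < x < q ^ m ->
  (forall c b a, 0 < c < m -> x = b * q ^ c + a -> a < q ^ c ->
     x <= a * q ^ (m - c) + b) ->
  coset_leader q (q ^ m - 1) x.
Proof.
move=> q_gt1 /andP[x_gt0 xm] shifts i k i_gt0.
have qmE : q ^ m = 1 %[mod q ^ m - 1].
  apply/eqP; rewrite eqn_mod_dvd //; lia.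
have xn : x <= q ^ m - 1 by lia.
have m_gt0 : 0 < m by case: (m) xm => //; rewrite expn0; lia.
have bound c a b : c < m -> a < q ^ c -> b < q ^ (m - c) ->
    a * q ^ (m - c) + b <= q ^ m - 1.
  move=> cm a_lt b_lt; have -> : q ^ m = q ^ c * q ^ (m - c).
    by rewrite -expnD subnKC // ltnW.
  have : a.+1 * q ^ (m - c) <= q ^ c * q ^ (m - c) by rewrite leq_mul2r a_lt orbT.
  by rewrite mulSn; lia.
move: (q ^ m - 1) qmE xn bound => n qmE xn bound.
rewrite -modnMmr (expn_modn_period _ qmE) modnMmr.
have : k %% m < m by rewrite ltn_mod.
move: (k %% m) => {}k km xE.
have [k0 | k_gt0] := posnP k.
  by move: xE; rewrite k0 expn0 muln1; apply: modn_eq_leq.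
have qk_gt0 : 0 < q ^ k by rewrite expn_gt0 (ltnW q_gt1).
have xba := divn_eq x (q ^ k).
have a_lt : x %% q ^ k < q ^ k by rewrite ltn_mod.
have b_lt : x %/ q ^ k < q ^ (m - k).
  by rewrite ltn_divLR // -expnD subnK // ltnW.
apply: (leq_trans (shifts k _ _ _ xba a_lt)); first by rewrite k_gt0.
apply: (@modn_eq_leq n) => //; first exact: bound.
rewrite -(shift_modn _ _ (ltnW km) qmE) -xba -modnMml xE modnMml.
by rewrite -mulnA -expnD subnKC ?(ltnW km) // -modnMmr qmE modnMmr muln1.
Qed.

(** The rotated word is itself the witness: multiplying it by [q ^ c] completes a full turn. *)
Lemma conj_to_smaller_shift q m n c a b : 0 < q -> c <= m ->
  q ^ m = 1 %[mod n] -> a * q ^ (m - c) + b < b * q ^ c + a ->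
  conj_to_smaller q n (b * q ^ c + a).
Proof.
move=> q_gt0 cm qm lt_y; exists (a * q ^ (m - c) + b), c; split.
  rewrite lt_y andbT addn_gt0 muln_gt0 expn_gt0 q_gt0 andbT.
  by move: lt_y; case: (posnP a) => [-> | //]; case: (b).
rewrite -modnMml -(shift_modn _ _ cm qm) modnMml -mulnA -expnD subnK //.
by rewrite -modnMmr qm modnMmr muln1.
Qed.

Lemma conj_to_smaller_dvd q n y : 1 < q -> 0 < y -> q %| y ->
  conj_to_smaller q n y.
Proof.
move=> q_gt1 y_gt0 qy; exists (y %/ q), 1.
by rewrite expn1 divnK // divn_gt0 ?(ltnW q_gt1) // dvdn_leq // ltn_Pdiv.
Qed.

Lemma divn_mod_unique d b a b' a' : a < d -> a' < d ->
  b * d + a = b' * d + a' -> b = b' /\ a = a'.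
Proof.
move=> ad a'd E; have d_gt0 : 0 < d by lia.
have := congr1 (divn^~ d) E; have := congr1 (modn^~ d) E.
by rewrite !modnMDl !divnMDl // !modn_small // !divn_small // !addn0.
Qed.

Lemma block_lt_expn q s t B a : B < q ^ (s - t) -> t <= s -> a < q ^ t ->
  B * q ^ t + a < q ^ s.
Proof.
move=> B_lt ts a_lt; have : B.+1 * q ^ t <= q ^ (s - t) * q ^ t.
  by rewrite leq_mul2r B_lt orbT.
rewrite -expnD subnK // mulSn; lia.
Qed.

Lemma coset_leader_block q h j t B a : 1 < q -> 3 * j < h ->
  h - j <= t <= h + j -> B < q ^ (h + j + 1 - t) -> a < q ^ (h - j) ->
  ~~ (q %| B) -> ~~ (q %| a) -> B * q ^ t + a <= a * q ^ (2 * h - t) + B ->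
  coset_leader q (q ^ (2 * h) - 1) (B * q ^ t + a).
Proof.
move=> q_gt1 jh /andP[t_ge t_le] B_lt a_lt qB qa ineq.
have q_gt0 := ltnW q_gt1.
have a_gt0 : 0 < a by case: (a) qa; rewrite ?dvdn0.
have B_gt0 : 0 < B by case: (B) qB; rewrite ?dvdn0.
have leq_exp x y : x <= y -> q ^ x <= q ^ y by rewrite leq_exp2l.
have a_ltP : a < q ^ t := leq_trans a_lt (leq_exp _ _ t_ge).
have x_lt : B * q ^ t + a < q ^ (h + j + 1) by apply: block_lt_expn => //; lia.
apply: coset_leader_shifts => //.
  rewrite addn_gt0 a_gt0 orbT; apply: (leq_trans x_lt); apply: leq_exp; lia.
move=> c b a' /andP[c_gt0 c_lt] xE a'_lt.
(* A remainder of at least q^y is shifted above q^(h + j + 1). *)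
have big y : h + j + 1 <= y + (2 * h - c) -> q ^ y <= a' ->
    B * q ^ t + a <= a' * q ^ (2 * h - c) + b.
  move=> yc a'_ge; apply: (leq_trans (ltnW x_lt)).
  apply: (@leq_trans (a' * q ^ (2 * h - c))); last exact: leq_addr.
  apply: (leq_trans (leq_exp _ _ yc)); rewrite expnD leq_mul2r a'_ge orbT //.
(* Cut inside [a]: [q] divides [B * q ^ t] and [q ^ c] but not [a], so the remainder is nonzero. *)
have [c_small | c_ge] := ltnP c (h - j).
  apply: (big 0); first lia.
  rewrite expn0 lt0n; apply/eqP => a'0; move: qa.
  rewrite -(@dvdn_addr (B * q ^ t)); last first.
    by rewrite dvdn_mull // dvdn_exp //; lia.
  by rewrite xE a'0 addn0 dvdn_mull // dvdn_exp.
(* Cut in the gap between [a] and [B]: the remainder is [a], and the rotation is [q ^ (t - c)] times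
   the one at [t]. *)
have [c_le | c_gt] := leqP c t.
  have : B * q ^ (t - c) * q ^ c + a = b * q ^ c + a'.
    by rewrite -mulnA -expnD subnK.
  case/divn_mod_unique => // [|<- <-].
    by apply: leq_trans a_lt (leq_exp _ _ c_ge).
  apply: (leq_trans ineq); rewrite (_ : 2 * h - c = 2 * h - t + (t - c)); last lia.
  by rewrite expnD mulnA leq_add // leq_pmulr // expn_gt0 q_gt0.
(* Cut inside [B]: as [q] does not divide [B], the remainder reaches [q ^ t], and [3 * j < h] gives
   [h + j + 1 <= t + (2 * h - c)]. *)
have [c_le | c_big] := leqP c (h + j).
  apply: (big t); first lia.
  rewrite leqNgt; apply/negP => a'_ltP.
  have : B * q ^ t + a = b * q ^ (c - t) * q ^ t + a'.
    by rewrite -mulnA -expnD subnK // ltnW.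
  case/divn_mod_unique => // BE _; move: qB.
  by rewrite BE dvdn_mull // dvdn_exp // subn_gt0.
(* Cut above all digits: rotating only multiplies by [q ^ (2 * h - c)]. *)
have b0 : b = 0.
  have : q ^ (h + j + 1) <= q ^ c by apply: leq_exp; lia.
  move: x_lt; rewrite xE; case: (b) => // b'; rewrite mulSn; lia.
by rewrite xE b0 mul0n add0n addn0 leq_pmulr // expn_gt0 q_gt0.
Qed.

End CosetLeaders.

(** * Zeros of the generator polynomial and the Bose distance *)

Section Algebra.
Local Open Scope ring_scope.
Variables (F : finFieldType) (E : fieldExtType F).
Local Notation q := #|F|.
Local Notation m := (\dim {:E}).

Lemma frobenius_rmorphism : {f : {rmorphism E -> E} | forall x, f x = x ^+ q}.
Proof.
pose f (x : E) := x ^+ q.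
have fD x y : (x + y) ^+ q = x ^+ q + y ^+ q :> E.
  have [p p_pr pF] := finPcharP F.
  rewrite exprDn_pchar // (card_pprimeChar pF) pnatX; apply/orP; left.
  by rewrite pnatE //= pchar_lalg.
have fA : zmod_morphism f.
  move=> x y; rewrite /f; apply/eqP; rewrite eq_sym subr_eq -fD.
  by rewrite subrK.
have fM : monoid_morphism f by split=> [|x y]; rewrite /f ?expr1n ?exprMn.
pose fa := GRing.isZmodMorphism.Build _ _ f fA.
pose fm := GRing.isMonoidMorphism.Build _ _ f fM.
pose fR : {rmorphism E -> E} := HB.pack f fa fm.
by exists fR.
Qed.

(** The product [P] of the ['X - b ^ (q ^ k)] is fixed by Frobenius, so it has coefficients in the
    base field and is a multiple of the minimal polynomial. *)
Lemma root_minPoly_conj (b x : E) :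
  root (minPoly 1 b) x -> exists k, x = b ^+ (q ^ k).
Proof.
have [f fE] := frobenius_rmorphism.
have fermat (a : E) : a ^+ (q ^ m) = a.
  by apply/eqP; rewrite -(Fermat's_little_theorem {:E}%AS) memvf.
pose P : {poly E} := \prod_(k < m) ('X - (b ^+ (q ^ k))%:P).
have m_gt0 : (0 < m)%N by exact: adim_gt0.
have PF : P \is a polyOver 1%AS.
  apply/polyOverP => i; rewrite (Fermat's_little_theorem 1%AS) dimv1 expn1.
  rewrite -fE -coef_map; apply/eqP; congr (_`_i).
  (* Frobenius sends factor [k] to factor [k + 1], and the last to the first by [fermat]: the last
     factor of the image is matched with the first of [P]. *)
  rewrite /P rmorph_prod /= -(prednK m_gt0) big_ord_recr big_ord_recl /= mulrC.
  rewrite rmorphB /= map_polyX map_polyC /= fE -exprM -expnSr prednK // fermat.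
  rewrite expn0 expr1.
  rewrite (eq_bigr (fun k : 'I_m.-1 => 'X - (b ^+ (q ^ bump 0 k))%:P)) // => k _.
  by rewrite rmorphB /= map_polyX map_polyC /= fE -exprM -expnSr.
have Pb : root P b.
  rewrite /P rootE horner_prod -(prednK m_gt0) big_ord_recl /=.
  by rewrite expn0 expr1 !hornerE subrr mul0r.
rewrite -dvdp_XsubCl => /dvdp_trans/(_ (minPoly_dvdp PF Pb)).
rewrite dvdp_XsubCl.
rewrite /P rootE horner_prod => /prodf_eq0[k _].
by rewrite !hornerE subr_eq0 => /eqP->; exists k.
Qed.

Local Notation "p ^E" := (map_poly (in_alg E) p) (at level 2).

Lemma dvdp_minPolyF (b : E) (p : {poly F}) :
  (minPolyF b %| p) = root p^E b.
Proof.
rewrite -(dvdp_map (in_alg E)) map_minPolyF; apply/idP/idP => [mp | rp].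
  by rewrite -dvdp_XsubCl (dvdp_trans _ mp) // dvdp_XsubCl root_minPoly.
apply: minPoly_dvdp => //; apply/polyOver1P; by exists p.
Qed.

(** Frobenius fixes the coefficients of [p], hence maps roots to roots. *)
Lemma root_frobenius (p : {poly F}) (b : E) k :
  root p^E b -> root p^E (b ^+ (q ^ k)).
Proof.
have [f fE] := frobenius_rmorphism.
elim: k => [|k IHk] rb; first by rewrite expn0 expr1.
rewrite expnSr exprM -fE -[p^E](_ : map_poly f p^E = _); last first.
  rewrite -map_poly_comp; apply: eq_map_poly => a /=.
  by rewrite fE -in_algE -rmorphXn expf_card.
by rewrite (fmorph_root f) IHk.
Qed.

Lemma dvdp_bch_gen (alpha : E) (d : nat) (p : {poly F}) :
  (bch_gen alpha d %| p) <->
  (forall i, (0 < i < d)%N -> root p^E (alpha ^+ i)).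
Proof.
have -> : (bch_gen alpha d %| p) =
    all (fun i => root p^E (alpha ^+ i)) (index_iota 1 d).
  rewrite /bch_gen; elim: index_iota => [|i s IHs] /=.
    by rewrite big_nil dvd1p.
  by rewrite big_cons dvdp_lcm IHs dvdp_minPolyF.
split=> [/allP H i i_d | H]; first by apply: H; rewrite mem_index_iota.
by apply/allP => i; rewrite mem_index_iota; apply: H.
Qed.

(** The lcm divides the product of the minimal polynomials, so each of its roots is a conjugate of
    some [alpha ^+ i]. *)
Lemma root_bch_gen (alpha x : E) (d : nat) :
  root (bch_gen alpha d)^E x ->
  exists i k, (0 < i < d)%N /\ x = alpha ^+ (i * q ^ k).
Proof.
pose P : {poly F} := \prod_(i <- index_iota 1 d) minPolyF (alpha ^+ i).
have gP : bch_gen alpha d %| P.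
  apply/dvdp_bch_gen => i i_d; rewrite -dvdp_minPolyF /P.
  by rewrite (big_rem i) ?mem_index_iota //= dvdp_mulr.
rewrite -dvdp_XsubCl => rg; have : root P^E x.
  by rewrite -dvdp_XsubCl (dvdp_trans rg) // dvdp_map.
rewrite rmorph_prod /= rootE horner_prod prodf_seq_eq0 => /hasP[i].
rewrite mem_index_iota map_minPolyF => i_d /root_minPoly_conj[k ->].
by exists i, k; rewrite exprM.
Qed.

Lemma map_polyXnsub1 n : ('X^n - 1 : {poly F})^E = 'X^n - 1.
Proof. by rewrite rmorphB rmorph1 /= map_polyXn. Qed.

Lemma bch_code_sub (alpha : E) d d' :
  bch_gen alpha d' %| bch_gen alpha d ->
  bch_code alpha d \subset bch_code alpha d'.
Proof.
move=> /dvdpP[p gE]; apply/subsetP => _ /imsetP[u _ ->].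
apply/imsetP; exists (in_qpoly _ p * u) => //.
by rewrite gE in_qpolyM mulrA [in_qpoly _ _ * in_qpoly _ p]mulrC.
Qed.

(** Vanishing at an n-th root of unity is well defined modulo ['X^n - 1], and the first generator is
    a multiple of the second in the quotient. *)
Lemma bch_gen_dvdp_of_code_sub (alpha x : E) d d' :
  (0 < bch_length E)%N -> x ^+ bch_length E = 1 ->
  bch_code alpha d \subset bch_code alpha d' ->
  root (bch_gen alpha d')^E x -> root (bch_gen alpha d)^E x.
Proof.
set n := bch_length E => n_gt0 xn sdd' rx.
have hM : ('X^n - 1 : {poly F}) \is monic by rewrite monicXnsubC.
(* [mk_monic] keeps its argument only if it is monic and nonconstant, whence [n > 0]. *)
have hE : mk_monic ('X^n - 1 : {poly F}) = 'X^n - 1.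
  by rewrite /mk_monic hM size_XnsubC // ltnS n_gt0.
have root_mod (p : {poly F}) : root p^E x = root (val (in_qpoly ('X^n - 1) p))^E x.
  rewrite /= hE [in LHS](Pdiv.RingMonic.rdivp_eq hM p).
  by rewrite /root rmorphD rmorphM /= map_polyXnsub1 !hornerE xn subrr mulr0 add0r.
have : in_qpoly ('X^n - 1) (bch_gen alpha d) \in bch_code alpha d'.
  apply: (subsetP sdd'); apply/imsetP; exists 1; by rewrite ?inE ?mulr1.
case/imsetP => u _ gE.
rewrite root_mod gE -[u](_ : in_qpoly _ (val u) = _); last first.
  by apply: val_inj; rewrite /= Pdiv.Ring.rmodp_small // size_mk_monic.
by rewrite -in_qpolyM -root_mod rmorphM rootM rx.
Qed.

Lemma bose_distance_eq (alpha : E) (delta X : nat) :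
  let n := bch_length E in
  n.-primitive_root alpha -> (1 < delta)%N -> next_leader q n delta X ->
  bose_distance alpha (bch_code alpha delta) = X.
Proof.
move=> n prim_a delta_gt1 [/andP[deltaX Xn] covered leader].
have gen_root d i : (0 < i < d)%N -> root (bch_gen alpha d)^E (alpha ^+ i).
  by move: i; apply/dvdp_bch_gen.
have n_gt0 : (0 < n)%N := prim_order_gt0 prim_a.
have codeX : bch_code alpha X = bch_code alpha delta.
  apply/eqP; rewrite eqEsubset !bch_code_sub //; last first.
    apply/dvdp_bch_gen => i /andP[i_gt0 i_lt]; apply: gen_root.
    by rewrite i_gt0 (leq_trans i_lt).
  (* Each exponent in [[delta, X)] is conjugate to a smaller one, whose power of [alpha] is a root
     by induction. *)
  apply/dvdp_bch_gen; elim/ltn_ind=> i IHi /andP[i_gt0 iX].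
  have [i_lt | i_ge] := ltnP i delta; first by rewrite gen_root ?i_gt0.
  have [|i' [k [/andP[i'_gt0 i'_lt] /eqP eq_i]]] := covered i.
    by rewrite i_ge.
  move: eq_i; rewrite -(eq_prim_root_expr prim_a) => /eqP->.
  by rewrite exprM root_frobenius // IHi // i'_gt0 (ltn_trans i'_lt).
apply/eqP; rewrite eqn_leq; apply/andP; split; last first.
  apply: leq_bigmax_seq; last by rewrite codeX.
  by rewrite mem_index_iota ltnS Xn (leq_trans delta_gt1).
apply/bigmax_leqP_seq => d; rewrite mem_index_iota => /andP[d_gt1 _] /eqP codeE.
rewrite leqNgt; apply/negP => Xd.
(* If [d > X] gave the same code, [alpha ^+ X] would be a zero for [delta], making [X] conjugate to
   some [i < delta <= X], against [leader]. *)
have rX : root (bch_gen alpha delta)^E (alpha ^+ X).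
  apply: (@bch_gen_dvdp_of_code_sub alpha _ _ d); rewrite ?codeE //.
    by rewrite exprAC (prim_expr_order prim_a) expr1n.
  by apply: gen_root; rewrite Xd (leq_trans _ deltaX) // ltnW.
have [i [k [/andP[i_gt0 i_lt] /eqP]]] := root_bch_gen rX.
rewrite (eq_prim_root_expr prim_a) => /eqP/(leader _ _ i_gt0).
by rewrite leqNgt (leq_trans i_lt).
Qed.
End Algebra.

(** * The next leader from [B * q ^ t + L] on, by comparing [L] with [U] *)

(* For delta as in the theorem, t = h + r, B = delta %/ q ^ t and
   L = delta %% q ^ t; U is B * q ^ t %/ q ^ (2 * h - t). *)
Section Block.
Variables q h j t B L : nat.
Hypotheses (q_gt1 : 1 < q) (jh : 3 * j < h) (t_bd : h - j <= t <= h + j).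
Hypotheses (B_lt : B < q ^ (h + j + 1 - t)) (qB : ~~ (q %| B)).

Let q_gt0 : 0 < q. Proof. exact: ltnW. Qed.
Let B_gt0 : 0 < B. Proof. by case: (B) qB; rewrite ?dvdn0. Qed.

Local Notation next := (next_leader q (q ^ (2 * h) - 1) (B * q ^ t + L)).

(** Up to the candidate only the low part moves. Each skipped [b] is ruled out by divisibility or by
    the rotation at [t]. *)
Lemma next_leader_block a : L <= a < q ^ (h - j) -> ~~ (q %| a) ->
  B * q ^ t + a <= a * q ^ (2 * h - t) + B ->
  (forall b, L <= b < a ->
     q %| b \/ b * q ^ (2 * h - t) + B < B * q ^ t + b) ->
  next (B * q ^ t + a).
Proof.
move=> /andP[La a_lt] qa ineq covered.
have [t_gt0 t_le t_lt exp_le] :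
    [/\ 0 < t, h - j <= t, t <= h + j + 1 & h + j + 1 <= 2 * h] by split; lia.
have qP : q %| B * q ^ t by rewrite dvdn_mull // dvdn_exp.
have x_lt : B * q ^ t + a < q ^ (h + j + 1).
  apply: block_lt_expn => //.
  by apply: (leq_trans a_lt); rewrite leq_exp2l.
split; last exact: coset_leader_block q_gt1 jh t_bd B_lt a_lt qB qa ineq.
  rewrite leq_add2l La -ltnS subn1 prednK ?expn_gt0 ?q_gt0 //.
  by apply: (leq_trans x_lt); rewrite leq_exp2l.
move=> y /andP[y_ge y_lt].
have yP : B * q ^ t <= y by apply: leq_trans y_ge; apply: leq_addr.
have bE : L <= y - B * q ^ t < a by rewrite leq_subRL // ltn_subLR // y_ge.
rewrite -(subnKC yP); case: (covered _ bE) => [qb | ltb].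
  apply: conj_to_smaller_dvd; rewrite ?dvdn_addr //.
  by rewrite addn_gt0 muln_gt0 B_gt0 expn_gt0 q_gt0.
apply: (conj_to_smaller_shift (m := 2 * h)) => //.
  by apply: leq_trans t_lt exp_le.
by apply/eqP; rewrite eqn_mod_dvd ?expn_gt0 ?q_gt0.
Qed.

Variable U : nat.
Hypothesis U_bd : U * q ^ (2 * h - t) <= B * q ^ t < U.+1 * q ^ (2 * h - t).

Lemma threshold_lt : U < q ^ (t + j + 1 - h).
Proof.
have /andP[UQ _] := U_bd.
have : U * q ^ (2 * h - t) < q ^ (t + j + 1 - h) * q ^ (2 * h - t).
  apply: (leq_ltn_trans UQ); rewrite -expnD.
  rewrite (_ : _ + _ = h + j + 1 - t + t); last lia.
  by rewrite expnD ltn_mul2r expn_gt0 q_gt0.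
by rewrite ltn_mul2r => /andP[].
Qed.

(** For [h <= t] the quotient defining [U] is exact, as [q ^ (2 * h - t)] divides [q ^ t]. *)
Lemma threshold_eq : h <= t -> U = B * q ^ (2 * t - 2 * h).
Proof.
move=> ht.
have : q ^ t = q ^ (2 * t - 2 * h) * q ^ (2 * h - t).
  by rewrite -expnD; congr (q ^ _); lia.
move: U_bd => + PE; rewrite PE mulnA leq_pmul2r ?ltn_pmul2r ?expn_gt0 ?q_gt0 //.
by rewrite ltnS -eqn_leq => /eqP.
Qed.

(** Here [U] is [B] with its last [2 * h - 2 * t] digits dropped; strictness comes from the nonzero
    last digit of [B]. *)
Lemma threshold_lt_lead : t < h -> U * q ^ (2 * h - 2 * t) < B.
Proof.
move=> th; have /andP[UQ _] := U_bd.
rewrite ltn_neqAle; apply/andP; split.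
  by apply: contraNneq qB => <-; rewrite dvdn_mull // dvdn_exp //; lia.
have : q ^ (2 * h - t) = q ^ (2 * h - 2 * t) * q ^ t.
  by rewrite -expnD; congr (q ^ _); lia.
by move: UQ => + QE; rewrite QE mulnA leq_pmul2r // expn_gt0 q_gt0.
Qed.

(** Raising [a] favours the left side, so [a = U] is the worst case. At [t = h] both sides agree
    there, hence the exclusion. *)
Lemma shift_lt_of_leq_threshold a : t <> h -> a <= U ->
  a * q ^ (2 * h - t) + B < B * q ^ t + a.
Proof.
move=> th aU; have /andP[UQ _] := U_bd.
have Q_gt0 : 0 < q ^ (2 * h - t) by rewrite expn_gt0 q_gt0.
suff : U * q ^ (2 * h - t) + B < B * q ^ t + U.
  have : (U - a) * 1 <= (U - a) * q ^ (2 * h - t) by rewrite leq_mul2l Q_gt0 orbT.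
  have : U * q ^ (2 * h - t) = a * q ^ (2 * h - t) + (U - a) * q ^ (2 * h - t).
    by rewrite -mulnDl subnKC.
  lia.
have [t_lt | t_gt | //] := ltngtP t h; last first.
  suff : B < U by lia.
  rewrite (threshold_eq (ltnW t_gt)) -[X in X < _]muln1 ltn_mul2l B_gt0.
  by rewrite -{1}(expn0 q) ltn_exp2l //; lia.
(* For [t < h] the truncation defining [U] loses at least [q ^ t], which exceeds [B]. *)
have : (U * q ^ (2 * h - 2 * t)).+1 * q ^ t <= B * q ^ t.
  by rewrite leq_mul2r threshold_lt_lead ?orbT.
have : B < q ^ t.
  by apply: (leq_trans B_lt); rewrite leq_exp2l //; lia.
have : q ^ (2 * h - t) = q ^ (2 * h - 2 * t) * q ^ t.
  by rewrite -expnD; congr (q ^ _); lia.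
by move=> ->; rewrite mulSn mulnA; lia.
Qed.

(** By the same monotonicity [a = U.+1] suffices. What is left is [U <= B] for [t < h], and
    [U < q ^ (2 * h - t)] otherwise. *)
Lemma shift_geq_of_gt_threshold a : U < a ->
  B * q ^ t + a <= a * q ^ (2 * h - t) + B.
Proof.
move=> Ua; have /andP[_ UQ] := U_bd.
have Q_gt0 : 0 < q ^ (2 * h - t) by rewrite expn_gt0 q_gt0.
suff : B * q ^ t + U.+1 <= U.+1 * q ^ (2 * h - t) + B.
  have : (a - U.+1) * 1 <= (a - U.+1) * q ^ (2 * h - t).
    by rewrite leq_mul2l Q_gt0 orbT.
  have : a * q ^ (2 * h - t) =
      U.+1 * q ^ (2 * h - t) + (a - U.+1) * q ^ (2 * h - t).
    by rewrite -mulnDl subnKC.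
  lia.
have [t_lt | t_ge] := ltnP t h.
  suff : U <= B by lia.
  apply: leq_trans (ltnW (threshold_lt_lead t_lt)).
  by rewrite leq_pmulr // expn_gt0 q_gt0.
have UE : B * q ^ t = U * q ^ (2 * h - t).
  by rewrite (threshold_eq t_ge) -mulnA -expnD; congr (_ * q ^ _); lia.
have : q ^ (t + j + 1 - h) <= q ^ (2 * h - t) by rewrite leq_exp2l //; lia.
by move: threshold_lt; rewrite UE mulSn; lia.
Qed.

Hypothesis L_lt : L < q ^ (h - j).

Lemma ndvdn_succ x : q %| x -> ~~ (q %| x.+1).
Proof. by move=> qx; rewrite -addn1 dvdn_addr // dvdn1 neq_ltn q_gt1 orbT. Qed.

Lemma dvdn_lt_succ x e : 0 < e -> q %| x -> x < q ^ e -> x.+1 < q ^ e.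
Proof.
move=> e_gt0 qx x_lt; rewrite ltn_neqAle x_lt andbT.
by apply: contra (ndvdn_succ qx) => /eqP->; rewrite dvdn_exp.
Qed.

Lemma next_leader_gt : U < L -> ~~ (q %| L) -> next (B * q ^ t + L).
Proof.
move=> UL qL; apply: next_leader_block => //; first by rewrite leqnn.
  exact: shift_geq_of_gt_threshold.
by move=> b; case: ltngtP.
Qed.

Lemma next_leader_gt_dvd : U <= L -> q %| L -> next (B * q ^ t + L + 1).
Proof.
move=> UL qL; rewrite -addnA addn1; apply: next_leader_block => //.
- rewrite leqnSn dvdn_lt_succ //; lia.
- exact: ndvdn_succ.
- exact: shift_geq_of_gt_threshold.
- move=> b b_bd; left; rewrite (_ : b = L) //; lia.
Qed.

Lemma next_leader_leq : t <> h -> L <= U -> ~~ (q %| U.+1) ->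
  next (B * q ^ t + U + 1).
Proof.
move=> th LU qU; rewrite -addnA addn1; apply: next_leader_block => //.
- rewrite leqW //= ltn_neqAle; apply/andP; split.
    by apply: contraNneq qU => ->; rewrite dvdn_exp //; lia.
  apply: leq_trans threshold_lt _.
  rewrite leq_exp2l //; lia.
- exact: shift_geq_of_gt_threshold.
- by move=> b b_bd; right; apply: shift_lt_of_leq_threshold; lia.
Qed.

Lemma next_leader_leq_dvd : t <> h -> L <= U -> q %| U.+1 ->
  next (B * q ^ t + U + 2).
Proof.
move=> th LU qU; rewrite -addnA addn2; apply: next_leader_block => //.
- rewrite !leqW //= dvdn_lt_succ //; first lia.
  apply: leq_ltn_trans threshold_lt _.
  rewrite ltn_exp2l //.
  (* For [t > h], [threshold_eq] makes [q] divide [U], contradicting [qU]; only [t < h] remains,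
     where the exponents leave room. *)
  have [t_lt | t_gt | //] := ltngtP t h; first lia.
  have qU' : q %| U.
    rewrite (threshold_eq (ltnW t_gt)).
    by rewrite dvdn_mull // dvdn_exp //; lia.
  by move: (ndvdn_succ qU'); rewrite qU.
- exact: ndvdn_succ.
- by apply: shift_geq_of_gt_threshold => //; lia.
- move=> b b_bd; have [-> | bU] := eqVneq b U.+1; first by left.
  by right; apply: shift_lt_of_leq_threshold; lia.
Qed.

(** At [t = h] one has [U = B], and [B * q ^ h + B] is invariant under rotation by [h], so the
    threshold itself is admissible. *)
Lemma next_leader_middle : t = h -> L <= U -> next (B * q ^ t + U).
Proof.
move=> th LU; have UB : U = B.
  by rewrite threshold_eq th // subnn muln1.
have Q_gt1 : 1 < q ^ h by rewrite -(expn0 q) ltn_exp2l //; lia.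
have hE : 2 * h - h = h by lia.
apply: next_leader_block; rewrite UB ?th ?hE //.
- rewrite -UB LU; apply: leq_trans threshold_lt _.
  rewrite leq_exp2l //; lia.
- move=> b /andP[_ bB]; right.
  have : (B - b) * 1 < (B - b) * q ^ h by rewrite ltn_mul2l subn_gt0 bB.
  by rewrite mulnBl; have := leq_mul (ltnW bB) (leqnn (q ^ h)); lia.
Qed.
End Block.

(** * Splitting q-adic expansions *)

Section Digits.
Variables (q : nat) (dg : nat -> nat).

Lemma sum_digits_split c N : c <= N ->
  \sum_(0 <= l < N) dg l * q ^ l =
    (\sum_(c <= l < N) dg l * q ^ (l - c)) * q ^ c +
    \sum_(0 <= l < c) dg l * q ^ l.
Proof.
move=> cN; rewrite (big_cat_nat (n := c)) //= addnC big_distrl /=.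
rewrite (@eq_big_nat _ _ _ c N _ (fun l => dg l * q ^ (l - c) * q ^ c)) //.
by move=> l /andP[cl _]; rewrite -mulnA -expnD subnK.
Qed.

Lemma sum_digits_lt c : (forall l, l < c -> dg l < q) ->
  \sum_(0 <= l < c) dg l * q ^ l < q ^ c.
Proof.
elim: c => [|c IHc] lt_q; first by rewrite big_geq.
rewrite big_nat_recr //= expnS.
have := IHc (fun l lc => lt_q l (ltnW lc)).
have : (dg c).+1 * q ^ c <= q * q ^ c by rewrite leq_mul2r lt_q ?orbT.
by rewrite mulSn; lia.
Qed.

Lemma sum_digits_head c N : c < N ->
  exists w, \sum_(c <= l < N) dg l * q ^ (l - c) = w * q + dg c.
Proof.
move=> cN; exists (\sum_(c.+1 <= l < N) dg l * q ^ (l - c.+1)).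
rewrite big_ltn // subnn muln1 addnC big_distrl /=.
rewrite (@eq_big_nat _ _ _ c.+1 N _ (fun l => dg l * q ^ (l - c.+1) * q)) //.
by move=> l /andP[cl _]; rewrite -mulnA -expnSr -subSn.
Qed.

(** Such an [l] is [h + s] with [s < r] in [[-j, j]], so minimality of [r] applies. This lets [L],
    cut at [h - j], be the whole part of [delta] below [h + r]. *)
Lemma low_digits_eq0 h j (r : int) : j <= h ->
  (forall s : int, (- (j%:Z) <= s <= j%:Z)%R ->
     0 < dg (absz (h%:Z + s)%R) -> (r <= s)%R) ->
  (- (j%:Z) <= r <= j%:Z)%R -> forall l, h - j <= l < absz (h%:Z + r)%R -> dg l = 0.
Proof.
move=> jh r_min /andP[r_ge r_le] l l_bd; apply/eqP; rewrite -leqn0 leqNgt; apply/negP.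
have lE : (h%:Z + (l%:Z - h%:Z) = l%:Z)%R by rewrite addrC subrK.
move=> dg_gt0; have := r_min (l%:Z - h%:Z)%R.
by rewrite lE absz_nat => /(_ _ dg_gt0); lia.
Qed.
End Digits.

(** * From the digits of [delta] to the block form, then the three cases *)

Theorem theorem7 (F : finFieldType) (E : fieldExtType F) (alpha : E)
    (q m h delta j : nat) (dg : nat -> nat) (r : int)
    (Fq : #|F| = q) (Em : \dim {:E} = m)
    (m_ge4 : 4 <= m) (m_even : ~~ odd m) (hE : h = m./2)
    (alpha_prim : ((q ^ m - 1).-primitive_root alpha)%R)
    (delta_ge : q ^ h <= delta)
    (delta_lt : delta < q ^ ((2 * m - 1) %/ 3 + 1))
    (jP : q ^ (h + j) <= delta < q ^ (h + j + 1))
    (dg_lt : forall l, l <= h + j -> dg l < q)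
    (dgE : delta = \sum_(0 <= l < (h + j).+1) dg l * q ^ l)
    (r_range : (- (j%:Z) <= r <= j%:Z)%R)
    (r_pos : 0 < dg (absz (h%:Z + r)%R))
    (r_min : forall s : int, (- (j%:Z) <= s <= j%:Z)%R ->
       0 < dg (absz (h%:Z + s)%R) -> (r <= s)%R) :
  let hpr := absz (h%:Z + r)%R in
  let hmr := absz (h%:Z - r)%R in
  let L := \sum_(0 <= l < h - j) dg l * q ^ l in
  let U := \sum_(hmr <= l < (h + j).+1) dg l * q ^ (l - hmr) in
  let hdelta := \sum_(hpr <= l < (h + j).+1) dg l * q ^ l + U in
  let dB := bose_distance alpha (bch_code alpha delta) in
  [/\ r <> 0%R -> ~~ (q %| delta) ->
        dB = (if U < L then delta
              else if dg hmr != q - 1 then hdelta + 1 else hdelta + 2),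
      r <> 0%R -> q %| delta ->
        dB = (if U <= L then delta + 1
              else if dg hmr != q - 1 then hdelta + 1 else hdelta + 2)
    & r = 0%R ->
        dB = (if U < L then (if ~~ (q %| delta) then delta else delta + 1)
              else hdelta)].
Proof.
move=> hpr hmr.
have q_gt1 : 1 < q by rewrite -Fq finNzRing_gt1.
have q_gt0 := ltnW q_gt1.
have mE : m = 2 * h by lia.
(* The upper bound on [delta] gives [h + j <= (4 * h - 1) %/ 3]. *)
have jh : 3 * j < h.
  have : q ^ (h + j) < q ^ ((2 * m - 1) %/ 3 + 1).
    by case/andP: jP => jP _; apply: leq_ltn_trans jP delta_lt.
  rewrite ltn_exp2l //; lia.
have j_le : j <= h by lia.
have t_bd : h - j <= hpr <= h + j by rewrite /hpr; lia.
have hmrE : hmr = 2 * h - hpr by rewrite /hmr /hpr; lia.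
have r0 : r = 0%R <-> hpr = h by rewrite /hpr; lia.
have [hj_gt0 hpr_lt hmr_lt hj_hpr hj_hmr] :
  [/\ 0 < h - j, hpr < (h + j).+1, hmr < (h + j).+1, h - j <= hpr
    & h - j <= hmr] by rewrite hmrE; clear -t_bd jh; split; lia.
have low_lt c : c <= (h + j).+1 -> forall l, l < c -> dg l < q.
  by move=> c_le l lc; apply: dg_lt; rewrite -ltnS (leq_trans lc).
have hj_le : h - j <= (h + j).+1.
  by rewrite leqW // (leq_trans (leq_subr _ _)) ?leq_addr.
move=> L U hdelta dB.
pose B := \sum_(hpr <= l < (h + j).+1) dg l * q ^ (l - hpr).
have zeros := low_digits_eq0 j_le r_min r_range.
have mid0 : \sum_(h - j <= l < hpr) dg l * q ^ l = 0.
  by rewrite big_nat_cond big1 // => l; rewrite andbT => /zeros->.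
have LE : L = \sum_(0 <= l < hpr) dg l * q ^ l.
  by case/andP: t_bd => *; rewrite (big_cat_nat (n := h - j)) //= mid0 addn0.
have L_lt : L < q ^ (h - j) by apply: sum_digits_lt; apply: low_lt.
have deltaE : delta = B * q ^ hpr + L.
  by rewrite dgE LE; apply: sum_digits_split; apply: ltnW.
have deltaU : delta = U * q ^ hmr + \sum_(0 <= l < hmr) dg l * q ^ l.
  by rewrite dgE; apply: sum_digits_split; apply: ltnW.
have hdeltaE : hdelta = B * q ^ hpr + U.
  rewrite /hdelta /B big_distrl /=; congr (_ + _); apply: eq_big_nat => l /andP[cl _].
  by rewrite -mulnA -expnD subnK.
have B_lt : B < q ^ (h + j + 1 - hpr).
  have : B * q ^ hpr < q ^ (h + j + 1 - hpr) * q ^ hpr.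
    rewrite -expnD subnK; last by rewrite addn1 ltnW.
    by case/andP: jP => _; rewrite deltaE; apply: leq_ltn_trans; apply: leq_addr.
  by rewrite ltn_mul2r => /andP[].
have qB : ~~ (q %| B).
  have [w ->] : exists w, B = w * q + dg hpr by apply: sum_digits_head.
  by rewrite dvdn_addr ?dvdn_mull // gtnNdvd // dg_lt.
have [w UE] : exists w, U = w * q + dg hmr by apply: sum_digits_head.
(* The last digit of [U] is [dg hmr], so [q] divides [U.+1] exactly when that digit carries. *)
have qU : (q %| U.+1) = (dg hmr == q - 1).
  rewrite UE -addnS dvdn_addr ?dvdn_mull //.
  have : dg hmr < q by apply: dg_lt.
  rewrite leq_eqVlt => /orP[/eqP dgq | dgq].
    by rewrite dgq dvdnn; apply/esym/eqP; clear -dgq; lia.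
  by rewrite gtnNdvd //; apply/esym/eqP; clear -dgq; lia.
have U_bd : U * q ^ (2 * h - hpr) <= B * q ^ hpr < U.+1 * q ^ (2 * h - hpr).
  rewrite -hmrE; apply/andP; split; last first.
    have : \sum_(0 <= l < hmr) dg l * q ^ l < q ^ hmr.
      by apply: sum_digits_lt; apply: low_lt => //; apply: ltnW.
    by move: deltaU; rewrite deltaE mulSn; clear; lia.
  have QE : q ^ hmr = q ^ (hmr - (h - j)) * q ^ (h - j).
    by rewrite -expnD subnK.
  have PE : q ^ hpr = q ^ (hpr - (h - j)) * q ^ (h - j).
    by rewrite -expnD subnK.
  have g_gt0 : 0 < q ^ (h - j) by rewrite expn_gt0 q_gt0.
  rewrite QE PE !mulnA leq_pmul2r // -ltnS -(ltn_pmul2r g_gt0) mulSn -!mulnA -QE -PE.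
  apply: (@leq_ltn_trans delta); first by rewrite deltaU leq_addr.
  by rewrite deltaE addnC ltn_add2r.
have qdelta : (q %| delta) = (q %| L).
  by rewrite deltaE dvdn_addr // dvdn_mull // dvdn_exp // (leq_trans hj_gt0).
have nE : bch_length E = q ^ (2 * h) - 1 by rewrite /bch_length Fq Em mE.
have dBE x : next_leader q (q ^ (2 * h) - 1) delta x -> dB = x.
  move=> next; apply: bose_distance_eq; rewrite ?nE ?Fq //; first by rewrite -mE.
  apply: leq_trans delta_ge; rewrite -(expn0 q) ltn_exp2l //.
  by apply: leq_ltn_trans jh.
rewrite qdelta hdeltaE {}deltaE in dBE *.
clear hdelta hdeltaE deltaU qdelta delta_ge delta_lt dgE UE jP zeros.
clearbody dB B L U; clearbody hpr hmr; clear LE.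
have next_leq : hpr <> h -> L <= U ->
    dB = if dg hmr != q - 1 then B * q ^ hpr + U + 1 else B * q ^ hpr + U + 2.
  move=> th LU; rewrite -qU; case: ifPn => [qU1 | /negPn qU1]; apply: dBE.
    exact: (next_leader_leq q_gt1 jh t_bd B_lt qB U_bd).
  exact: (next_leader_leq_dvd q_gt1 jh t_bd B_lt qB U_bd).
split=> [r_neq0 qL | r_neq0 qL | /r0 th].
- have [UL | LU] := ltnP U L.
    by apply: dBE; apply: (next_leader_gt q_gt1 jh t_bd B_lt qB U_bd).
  by apply: next_leq => //; move/r0.
- have [UL | LU] := leqP U L.
    by apply: dBE; apply: (next_leader_gt_dvd q_gt1 jh t_bd B_lt qB U_bd).
  by apply: next_leq (ltnW LU); move/r0.
- have [UL | LU] := ltnP U L; last first.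
    by apply: dBE; apply: (next_leader_middle q_gt1 jh t_bd B_lt qB U_bd).
  case: ifPn => [qL | /negPn qL]; apply: dBE.
    exact: (next_leader_gt q_gt1 jh t_bd B_lt qB U_bd).
  by apply: (next_leader_gt_dvd q_gt1 jh t_bd B_lt qB U_bd) => //; apply: ltnW.
Qed.
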